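(* Let $M$ be a countable transitive model of $\mathsf{ZFC}$, let $c$ and $d$ be mutually generic Cohen reals over $M$, and let $g\colon\omega\to2$ be any function (not necessarily in $M$). Then the graft $c\wr_d g$ is a Cohen real over $M$, where $d$ is identified with the set $d^{-1}[\{1\}]\subseteq\omega$.
   Context: Cohen reals are $M$-generic functions $\omega\to2$ for $\mathrm{Add}(\omega,1)$ (finite binary strings). For (partial) functions $f,g$ on $\omega$ and $A\subseteq\mathrm{dom}(f)$ of the same cardinality as $\mathrm{dom}(g)$, let $e\colon A\to\mathrm{dom}(g)$ be the order-preserving bijection; the graft $f\wr_A g$ is the function on $\mathrm{dom}(f)$ with $(f\wr_A g)(x)=f(x)$ for $x\notin A$ and $(f\wr_A g)(x)=g(e(x))$ for $x\in A$. *)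

(* Defs.v *)
From mathcomp Require Import all_boot.
From mathcomp Require Import classical_sets functions.

Set Implicit Arguments.
Unset Strict Implicit.
Unset Printing Implicit Defensive.

Local Open Scope classical_set_scope.

(** * The ambient universe of sets *)

(* Aczel's sets: [Sup A f] is the set {f a | a : A}.  Distinct terms may denote
   the same set; equality of sets is [Veq], not Leibniz equality. *)
Inductive V : Type := Sup (A : Type) (f : A -> V).

Fixpoint Veq (x y : V) : Prop :=
  match x, y with
  | Sup A f, Sup B g =>
      (forall a, exists b, Veq (f a) (g b)) /\
      (forall b, exists a, Veq (f a) (g b))
  end.

Definition Vin (x y : V) : Prop :=
  match y with Sup B g => exists b, Veq x (g b) end.

Definition Vupair (x y : V) : V := Sup (fun b : bool => if b then x else y).

(* Kuratowski pair {{x}, {x, y}} *)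
Definition Vpair (x y : V) : V := Vupair (Vupair x x) (Vupair x y).

(* von Neumann numeral: [Vnat n.+1] is [Vnat n] together with itself *)
Fixpoint Vnat (n : nat) : V :=
  match n with
  | 0 => Sup (fun i : void => match i with end)
  | m.+1 =>
      match Vnat m with
      | Sup A f => Sup (fun o : option A => if o is Some a then f a else Sup f)
      end
  end.

(** * First-order formulas of set theory and ZFC *)

(* Variables are named by natural numbers. *)
Inductive form : Type :=
| fMem (i j : nat)
| fEq (i j : nat)
| fNot (p : form)
| fAnd (p q : form)
| fOr (p q : form)
| fImp (p q : form)
| fAll (i : nat) (p : form)
| fEx (i : nat) (p : form).

Definition fIff (p q : form) : form := fAnd (fImp p q) (fImp q p).

Fixpoint free_in (n : nat) (p : form) : bool :=
  match p with
  | fMem i j | fEq i j => (n == i) || (n == j)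
  | fNot q => free_in n q
  | fAnd q r | fOr q r | fImp q r => free_in n q || free_in n r
  | fAll i q | fEx i q => (n != i) && free_in n q
  end.

Definition update (v : nat -> V) (i : nat) (a : V) : nat -> V :=
  fun j => if j == i then a else v j.

(* Tarski satisfaction in the structure (M, \in) *)
Fixpoint sat (M : V) (v : nat -> V) (p : form) : Prop :=
  match p with
  | fMem i j => Vin (v i) (v j)
  | fEq i j => Veq (v i) (v j)
  | fNot q => ~ sat M v q
  | fAnd q r => sat M v q /\ sat M v r
  | fOr q r => sat M v q \/ sat M v r
  | fImp q r => sat M v q -> sat M v r
  | fAll i q => forall a, Vin a M -> sat M (update v i a) q
  | fEx i q => exists a, Vin a M /\ sat M (update v i a) q
  end.

(* Structures are nonempty, and free variables of axioms are read as universally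
   quantified. *)
Definition models (M : V) (T : form -> Prop) : Prop :=
  (exists x, Vin x M) /\
  forall p, T p -> forall v, (forall i, Vin (v i) M) -> sat M v p.

Definition ax_extensionality : form :=
  fAll 0 (fAll 1
    (fImp (fAll 2 (fIff (fMem 2 0) (fMem 2 1))) (fEq 0 1))).

Definition ax_foundation : form :=
  fAll 0 (fImp (fEx 1 (fMem 1 0))
    (fEx 1 (fAnd (fMem 1 0) (fNot (fEx 2 (fAnd (fMem 2 0) (fMem 2 1))))))).

Definition ax_pairing : form :=
  fAll 0 (fAll 1 (fEx 2 (fAll 3
    (fIff (fMem 3 2) (fOr (fEq 3 0) (fEq 3 1)))))).

Definition ax_union : form :=
  fAll 0 (fEx 1 (fAll 2
    (fIff (fMem 2 1) (fEx 3 (fAnd (fMem 3 0) (fMem 2 3)))))).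

Definition ax_powerset : form :=
  fAll 0 (fEx 1 (fAll 2
    (fIff (fMem 2 1) (fAll 3 (fImp (fMem 3 2) (fMem 3 0)))))).

(* some set contains the empty set and is closed under y |-> y \cup {y} *)
Definition ax_infinity : form :=
  fEx 0 (fAnd
    (fEx 1 (fAnd (fMem 1 0) (fAll 2 (fNot (fMem 2 1)))))
    (fAll 1 (fImp (fMem 1 0)
      (fEx 2 (fAnd (fMem 2 0)
        (fAll 3 (fIff (fMem 3 2) (fOr (fMem 3 1) (fEq 3 1))))))))).

(* every set of nonempty pairwise disjoint sets has a transversal *)
Definition ax_choice : form :=
  fAll 0 (fImp
    (fAnd
      (fAll 1 (fImp (fMem 1 0) (fEx 2 (fMem 2 1))))
      (fAll 1 (fAll 2 (fImp (fAnd (fMem 1 0) (fMem 2 0))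
        (fImp (fEx 3 (fAnd (fMem 3 1) (fMem 3 2))) (fEq 1 2))))))
    (fEx 4 (fAll 1 (fImp (fMem 1 0)
      (fEx 2 (fAll 3
        (fIff (fAnd (fMem 3 1) (fMem 3 4)) (fEq 3 2)))))))).

(* forall a, exists b, forall x, x \in b <-> x \in a /\ p(x), where the
   variables x, a, b are 0, 1, 2 and b is not free in p *)
Definition ax_separation (p : form) : form :=
  fAll 1 (fEx 2 (fAll 0 (fIff (fMem 0 2) (fAnd (fMem 0 1) p)))).

(* forall a, (forall x \in a, exists! y, p(x, y)) ->
   exists b, forall x \in a, exists y \in b, p(x, y), where the variables
   x, y, a, b are 0, 1, 2, 3; [exists! y, p] is rendered as
   [exists z, forall y, p <-> y = z] with z the variable 4, and neither b nor z
   is free in p *)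
Definition ax_replacement (p : form) : form :=
  fAll 2 (fImp
    (fAll 0 (fImp (fMem 0 2) (fEx 4 (fAll 1 (fIff p (fEq 1 4))))))
    (fEx 3 (fAll 0 (fImp (fMem 0 2) (fEx 1 (fAnd (fMem 1 3) p)))))).

Inductive ZFC : form -> Prop :=
| ZFC_extensionality : ZFC ax_extensionality
| ZFC_foundation : ZFC ax_foundation
| ZFC_pairing : ZFC ax_pairing
| ZFC_union : ZFC ax_union
| ZFC_powerset : ZFC ax_powerset
| ZFC_infinity : ZFC ax_infinity
| ZFC_choice : ZFC ax_choice
| ZFC_separation p : ~~ free_in 2 p -> ZFC (ax_separation p)
| ZFC_replacement p :
    ~~ free_in 3 p -> ~~ free_in 4 p -> ZFC (ax_replacement p).

Definition transitive_set (M : V) : Prop :=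
  forall x y, Vin x M -> Vin y x -> Vin y M.

Definition countable_set (M : V) : Prop :=
  exists f : nat -> V, forall x, Vin x M -> exists n, Veq x (f n).

Definition ctm (M : V) : Prop :=
  [/\ countable_set M, transitive_set M & models M ZFC].

(** * Forcing *)

(* [extends q p] means that q is stronger than p (q <= p); [code] says which
   set each condition is, so that "D is an element of M" makes sense for a set
   D of conditions. *)
Record forcing := Forcing {
  cond :> Type;
  extends : cond -> cond -> Prop;
  code : cond -> V
}.

Definition dense_in (P : forcing) (D : V) : Prop :=
  (forall x, Vin x D -> exists p : P, Veq x (code p)) /\
  (forall p : P, exists q : P, extends q p /\ Vin (code q) D).

Definition is_filter (P : forcing) (G : set P) : Prop :=
  [/\ G !=set0,
      forall p q, G q -> extends q p -> G p &
      forall p q, G p -> G q -> exists r, [/\ G r, extends r p & extends r q]].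

Definition generic_filter (M : V) (P : forcing) (G : set P) : Prop :=
  is_filter G /\
  forall D, Vin D M -> dense_in P D -> exists p, G p /\ Vin (code p) D.

(* a binary string as a function {0, ..., n-1} -> {0, 1}, i.e. a set of pairs *)
Definition Vstring (s : seq bool) : V :=
  Sup (fun i : 'I_(size s) => Vpair (Vnat i) (Vnat (nth false s i))).

(* Add(omega, 1) *)
Definition Add : forcing :=
  @Forcing (seq bool) (fun t s => prefix s t) Vstring.

Definition prod_forcing (P Q : forcing) : forcing :=
  @Forcing (P * Q)%type
    (fun r s => extends r.1 s.1 /\ extends r.2 s.2)
    (fun r => Vpair (code r.1) (code r.2)).

Definition initial_segments (c : nat -> bool) : set (seq bool) :=
  [set s | s = mkseq c (size s)].

Definition Cohen_real (M : V) (c : nat -> bool) : Prop :=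
  @generic_filter M Add (initial_segments c).

Definition mutually_generic_Cohen (M : V) (c d : nat -> bool) : Prop :=
  @generic_filter M (prod_forcing Add Add)
    (initial_segments c `*` initial_segments d).

(** * Grafting *)

(* Partial functions on omega are maps nat -> option T. *)
Definition pdom T (f : nat -> option T) : set nat := [set x | f x <> None].

Definition as_partial T (f : nat -> T) : nat -> option T := fun x => Some (f x).

Definition order_bij (A B : set nat) (e : nat -> nat) : Prop :=
  set_bij A B e /\ forall x y, A x -> A y -> x < y -> e x < e y.

(* [is_graft f A g h] says that the graft of g onto f along A is defined (A is
   included in dom f and has the same cardinality as dom g) and equals h.  Two
   subsets of omega of equal cardinality have a unique order-preserving
   bijection, so h is determined by f, A and g. *)
Definition is_graft T (f : nat -> option T) (A : set nat)
    (g h : nat -> option T) : Prop :=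
  A `<=` pdom f /\
  exists e, [/\ order_bij A (pdom g) e,
                forall x, A x -> h x = g (e x) &
                forall x, ~ A x -> h x = f x].

(* Main.v *)
(** If [(p, q)] is a condition and [h] the graft, then [h] may differ from [p]
    only where [q] is 1, whatever [g] is.  Hence, given a dense [D], it suffices
    that the generic meets the set of pairs [(p, q)] such that every string
    agreeing with [p] wherever [q] is 0 extends an element of [D].  This set
    is dense: pad [q] with zeros and extend [p] once for each of the finitely
    many ways to fill the positions of the ones.  No order isomorphism occurs in
    its definition, so it is Delta_0-definable from [D], omega and the set of
    strings, and lies in [M] by separation.  A second dense set shows that [d]
    takes the value 1 infinitely often, so that the graft is defined. *)

Require Import Defs.
From mathcomp Require Import all_boot.
From mathcomp Require Import boolp classical_sets functions.

Set Implicit Arguments.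
Unset Strict Implicit.
Unset Printing Implicit Defensive.

Local Open Scope classical_set_scope.

(** * Sets and codes of strings *)

Lemma Veq_refl x : Veq x x.
Proof. by elim: x => A f IH; split=> a; exists a. Qed.

Lemma Veq_sym x y : Veq x y -> Veq y x.
Proof.
elim: x y => A f IH [B g] [H1 H2]; split.
- by move=> b; have [a /IH] := H2 b; exists a.
- by move=> a; have [b /IH] := H1 a; exists b.
Qed.

Lemma Veq_trans x y z : Veq x y -> Veq y z -> Veq x z.
Proof.
elim: x y z => A f IH [B g] [C h] [H1 H2] [H3 H4]; split.
- move=> a; have [b Hb] := H1 a; have [c Hc] := H3 b; exists c; exact: IH Hb Hc.
- move=> c; have [b Hb] := H4 c; have [a Ha] := H2 b; exists a; exact: IH Ha Hb.
Qed.

Lemma Vin_eql x x' y : Veq x x' -> Vin x y -> Vin x' y.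
Proof. by case: y => B g /Veq_sym xx' [b Hb]; exists b; apply: Veq_trans Hb. Qed.

Lemma Vin_eqr x y y' : Veq y y' -> Vin x y -> Vin x y'.
Proof.
case: y y' => [B g] [B' g'] [H _] [b Hb].
by have [b' Hb'] := H b; exists b'; apply: Veq_trans Hb'.
Qed.

Lemma Vext x y : (forall z, Vin z x <-> Vin z y) -> Veq x y.
Proof.
case: x y => [A f] [B g] H; split.
- by move=> a; apply/(H (f a)); exists a; apply: Veq_refl.
- move=> b; have /H [a Ha] : Vin (g b) (Sup g) by exists b; apply: Veq_refl.
  by exists a; apply: Veq_sym.
Qed.

Lemma VextE x y : Veq x y <-> forall z, Vin z x <-> Vin z y.
Proof.
split=> [xy z|]; last exact: Vext.
by split; apply: Vin_eqr => //; apply: Veq_sym.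
Qed.

Lemma Vin_irrefl x : ~ Vin x x.
Proof.
(* Members are known only up to [Veq], so the induction on terms has to carry every [y] equal to
   [x]. *)
suff: forall y, Veq y x -> ~ Vin y y by apply; apply: Veq_refl.
elim: x => A f IH y yx yy.
have [a Ha] := Vin_eqr yx yy.
exact: IH Ha yy.
Qed.

Lemma Vin_ind (P : V -> Prop) :
  (forall x, (forall y, Vin y x -> P y) -> P x) -> forall x, P x.
Proof.
move=> H x; suff: forall y, Veq y x -> P y by apply; apply: Veq_refl.
elim: x => A f IH y yx; apply: H => z zy.
by have [a] := Vin_eqr yx zy; apply: IH.
Qed.

Lemma Vin_upair z x y : Vin z (Vupair x y) <-> Veq z x \/ Veq z y.
Proof.
by split=> [[[] H]|[H|H]]; [left|right|exists true|exists false].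
Qed.

Lemma Vupair_eq x x' y y' :
  Veq x x' -> Veq y y' -> Veq (Vupair x y) (Vupair x' y').
Proof. by move=> ? ?; split; move=> b; exists b; case: b. Qed.

Lemma Vupair_inj x y x' y' : Veq (Vupair x y) (Vupair x' y') ->
  (Veq x x' /\ Veq y y') \/ (Veq x y' /\ Veq y x').
Proof.
case=> H1 H2.
have [[] /= a] := H1 true; have [[] /= b] := H1 false.
- have [[] /= e] := H2 false; last by left.
  by left; split=> //; apply: (Veq_trans b); apply: (Veq_trans (Veq_sym a)).
- by left.
- by right.
- have [[] /= e] := H2 true; last by right.
  by left; split=> //.
Qed.

Lemma Vpair_eq x x' y y' :
  Veq x x' -> Veq y y' -> Veq (Vpair x y) (Vpair x' y').
Proof. by move=> *; do 2?[apply: Vupair_eq]. Qed.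

Lemma Vpair_inj x y x' y' :
  Veq (Vpair x y) (Vpair x' y') -> Veq x x' /\ Veq y y'.
Proof.
case/Vupair_inj=> -[/Vupair_inj H1 /Vupair_inj H2].
- have xx' : Veq x x' by case: H1 => -[].
  split=> //; case: H2 => -[] // a b.
  by apply: (Veq_trans b); apply: (Veq_trans (Veq_sym xx')); exact: a.
- have [a b] : Veq x x' /\ Veq x y' by case: H1 => -[].
  have [c e] : Veq x x' /\ Veq y x' by case: H2 => -[].
  by split=> //; apply: (Veq_trans e); apply: (Veq_trans (Veq_sym a)).
Qed.

Lemma Vin_nat x n : Vin x (Vnat n) <-> exists2 m, m < n & Veq x (Vnat m).
Proof.
elim: n x => [|n IH] x /=; first by split=> [[[]]|[]].
have -> : Vin x match Vnat n with
  | @Sup A f => Sup (fun o => if o is Some a then f a else Sup f)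
  end <-> Vin x (Vnat n) \/ Veq x (Vnat n).
  case: (Vnat n) => A f; split; first by case=> -[a|] H; [left; exists a|right].
  by case=> [[a H]|H]; [exists (Some a)|exists None].
rewrite IH; split.
- case=> [[m mn e]|e]; last by exists n.
  by exists m => //; apply: ltnW.
- case=> m; rewrite ltnS leq_eqVlt => /orP[/eqP-> | mn]; first by right.
  by left; exists m.
Qed.

Lemma Vnat_inj m n : Veq (Vnat m) (Vnat n) -> m = n.
Proof.
wlog mn : m n / m < n => [H e|].
  have [l|l|//] := ltngtP m n; first exact: H.
  by symmetry; apply: H => //; apply: Veq_sym.
move=> e; exfalso; apply: (@Vin_irrefl (Vnat n)).
by apply: (Vin_eql e); apply/Vin_nat; exists m => //; apply: Veq_refl.
Qed.

Lemma Vnat_in m n : Vin (Vnat m) (Vnat n) <-> m < n.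
Proof.
rewrite Vin_nat; split=> [[k kn /Vnat_inj->] //|mn].
by exists m => //; apply: Veq_refl.
Qed.

Lemma Vin_natS x n : Vin x (Vnat n.+1) <-> Vin x (Vnat n) \/ Veq x (Vnat n).
Proof.
rewrite !Vin_nat; split.
- case=> m; rewrite ltnS leq_eqVlt => /orP[/eqP-> | mn]; first by right.
  by left; exists m.
- case=> [[m mn e]|e]; last by exists n.
  by exists m => //; apply: ltnW.
Qed.

Lemma Vin_string x s : Vin x (Vstring s) <->
  exists2 i, i < size s & Veq x (Vpair (Vnat i) (Vnat (nth false s i))).
Proof.
split=> [[i H]|[i ilt H]]; first by exists i.
by exists (Ordinal ilt).
Qed.

Lemma Vstring_in i b s :
  Vin (Vpair (Vnat i) (Vnat (b : bool))) (Vstring s) <->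
  i < size s /\ nth false s i = b.
Proof.
rewrite Vin_string; split=> [[j js /Vpair_inj[/Vnat_inj-> /Vnat_inj H]]|[H <-]].
  by split=> //; move: H; case: b; case: nth.
by exists i => //; apply: Veq_refl.
Qed.

Lemma prefix_nthP (s t : seq bool) : prefix s t <->
  forall i, i < size s -> i < size t /\ nth false t i = nth false s i.
Proof.
split=> [/prefixP[r ->] i i_s | H].
  by rewrite size_cat nth_cat i_s ltn_addr.
have st : size s <= size t.
  rewrite leqNgt; apply/negP => ts.
  by have [] := H _ ts; rewrite ltnn.
rewrite prefixE; apply/eqP/(@eq_from_nth _ false); rewrite size_takel // => i i_s.
by rewrite nth_take //; have [] := H i i_s.
Qed.

(** Turns the order of [Add] into inclusion of codes, which a bounded formula can express. *)
Lemma Vstring_sub s t :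
  (forall x, Vin x (Vstring s) -> Vin x (Vstring t)) <-> prefix s t.
Proof.
rewrite prefix_nthP; split=> H.
  by move=> i i_s; apply/Vstring_in/H/Vstring_in.
move=> x /Vin_string[i i_s xi]; apply: (Vin_eql (Veq_sym xi)).
by apply/Vstring_in/H.
Qed.

(** * Absoluteness of bounded formulas *)

(** Delta_0 formulas, with Kuratowski pairing as an extra atom because it is absolute for transitive
    sets. Their semantics [eval] does not mention [M], so definitions can be checked in the full
    universe. *)
Inductive d0 : Type :=
| DMem (i j : nat)
| DEq (i j : nat)
| DPair (k i j : nat)
| DNot (p : d0)
| DAnd (p q : d0)
| DOr (p q : d0)
| DImp (p q : d0)
| DAll (i j : nat) (p : d0)
| DEx (i j : nat) (p : d0).

Fixpoint eval (v : nat -> V) (p : d0) : Prop :=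
  match p with
  | DMem i j => Vin (v i) (v j)
  | DEq i j => Veq (v i) (v j)
  | DPair k i j => Veq (v k) (Vpair (v i) (v j))
  | DNot q => ~ eval v q
  | DAnd q r => eval v q /\ eval v r
  | DOr q r => eval v q \/ eval v r
  | DImp q r => eval v q -> eval v r
  | DAll i j q => forall a, Vin a (v j) -> eval (update v i a) q
  | DEx i j q => exists a, Vin a (v j) /\ eval (update v i a) q
  end.

Definition f_upair (k i j n : nat) : form :=
  fAll n (fIff (fMem n k) (fOr (fEq n i) (fEq n j))).

(** The index [a] exceeds [k], [i] and [j], so the bound variables [a], [a.+1] and [a.+2] capture
    none of them. *)
Definition f_pair (k i j : nat) : form :=
  let a := (k + i + j).+1 in
  fEx a (fEx a.+1 (fAnd (f_upair a i i a.+2)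
    (fAnd (f_upair a.+1 i j a.+2) (f_upair k a a.+1 a.+2)))).

Fixpoint compile (p : d0) : form :=
  match p with
  | DMem i j => fMem i j
  | DEq i j => fEq i j
  | DPair k i j => f_pair k i j
  | DNot q => fNot (compile q)
  | DAnd q r => fAnd (compile q) (compile r)
  | DOr q r => fOr (compile q) (compile r)
  | DImp q r => fImp (compile q) (compile r)
  | DAll i j q => fAll i (fImp (fMem i j) (compile q))
  | DEx i j q => fEx i (fAnd (fMem i j) (compile q))
  end.

(* In [DAll i j p] the bound [v j] is read outside the scope of [i]; the
   compiled formula reads it inside, so the two must be different variables. *)
Fixpoint wf (p : d0) : bool :=
  match p with
  | DMem _ _ | DEq _ _ | DPair _ _ _ => true
  | DNot q => wf q
  | DAnd q r | DOr q r | DImp q r => wf q && wf r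
  | DAll i j q | DEx i j q => (i != j) && wf q
  end.

Lemma update_same v i a : update v i a i = a.
Proof. by rewrite /update eqxx. Qed.

Lemma update_neq v i j a : i != j -> update v i a j = v j.
Proof. by rewrite /update eq_sym => /negbTE->. Qed.

Lemma update_in M v i a : (forall j, Vin (v j) M) -> Vin a M ->
  forall j, Vin (update v i a j) M.
Proof. by move=> vM aM j; rewrite /update; case: eqP. Qed.

Lemma sat_upair M v k i j n : transitive_set M -> (forall l, Vin (v l) M) ->
  k < n -> i < n -> j < n ->
  sat M v (f_upair k i j n) <-> Veq (v k) (Vupair (v i) (v j)).
Proof.
move=> tM vM kn il jn /=.
have E a l : l < n -> update v n a l = v l.
  by move=> ln; rewrite update_neq // gtn_eqF.
split=> [H|H a aM]; last first.
  rewrite update_same !E //; rewrite -Vin_upair; move/VextE: H => H.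
  by split=> /H.
apply: Vext => z; split=> Hz.
  have zM := tM _ _ (vM k) Hz.
  have := H z zM; rewrite update_same !E // => -[H1 _].
  by apply/Vin_upair/H1.
have zM : Vin z M.
  by case/Vin_upair: Hz => /Veq_sym e; apply: Vin_eql e _.
have := H z zM; rewrite update_same !E // => -[_ H1].
by apply/H1/Vin_upair.
Qed.

Lemma sat_pair M v k i j : transitive_set M -> (forall l, Vin (v l) M) ->
  sat M v (f_pair k i j) <-> Veq (v k) (Vpair (v i) (v j)).
Proof.
move=> tM vM; rewrite /f_pair; set a := (k + i + j).+1.
have ka : k < a by rewrite ltnS -addnA leq_addr.
have ia : i < a by rewrite ltnS addnAC leq_addl.
have ja : j < a by rewrite ltnS leq_addl.
have U x y : Vin x M -> Vin y M ->
    sat M (update (update v a x) a.+1 y) (fAnd (f_upair a i i a.+2)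
      (fAnd (f_upair a.+1 i j a.+2) (f_upair k a a.+1 a.+2))) <->
    [/\ Veq x (Vupair (v i) (v i)), Veq y (Vupair (v i) (v j)) &
      Veq (v k) (Vupair x y)].
  move=> xM yM; set w := update _ _ _.
  have wM : forall l, Vin (w l) M by do 2!apply: update_in => //.
  have wE l : l < a -> w l = v l.
    move=> la; rewrite /w !update_neq // gtn_eqF //; exact: ltnW.
  have wa : w a = x by rewrite /w update_neq ?update_same // gtn_eqF.
  have wa' : w a.+1 = y by rewrite /w update_same.
  change (sat M w (f_upair a i i a.+2) /\ sat M w (f_upair a.+1 i j a.+2) /\
    sat M w (f_upair k a a.+1 a.+2) <->
    [/\ Veq x (Vupair (v i) (v i)), Veq y (Vupair (v i) (v j)) &
      Veq (v k) (Vupair x y)]).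
  have L l : l < a -> l < a.+2 by move=> la; do 2!apply: ltnW.
  rewrite !sat_upair //; try solve [exact: L | exact: ltnW].
  by rewrite wa wa' !wE //; split=> [[? []]|[]].
split.
  case=> x [xM [y [yM /(U _ _ xM yM)[ex ey e]]]].
  exact: (Veq_trans e (Vupair_eq ex ey)).
(* The two inner sets of the Kuratowski pair are members of [v k], so transitivity supplies them as
   witnesses in [M]. *)
move=> e; have inM x : Vin x (Vpair (v i) (v j)) -> Vin x M.
  by move=> H; apply: (tM (v k)) => //; apply: Vin_eqr H; apply: Veq_sym.
have xM : Vin (Vupair (v i) (v i)) M.
  by apply: inM; apply/Vin_upair; left; apply: Veq_refl.
have yM : Vin (Vupair (v i) (v j)) M.
  by apply: inM; apply/Vin_upair; right; apply: Veq_refl.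
exists (Vupair (v i) (v i)); split=> //.
exists (Vupair (v i) (v j)); split=> //.
by apply/U => //; split=> //; apply: Veq_refl.
Qed.

(** A bounded quantifier ranges over members of some [v j]; these all lie in the transitive set [M],
    so restricting it to [M] changes nothing. *)
Lemma sat_compile M p v : transitive_set M -> wf p ->
  (forall l, Vin (v l) M) -> sat M v (compile p) <-> eval v p.
Proof.
move=> tM; elim: p v => [i j|i j|k i j|q IH|q IHq r IHr|q IHq r IHr|q IHq r IHr
  |i j q IH|i j q IH] v; rewrite [wf _]/=.
- by [].
- by [].
- by move=> _ vM; apply: sat_pair.
- by move=> w vM /=; rewrite IH.
- by move=> /andP[wq wr] vM /=; rewrite IHq // IHr.
- by move=> /andP[wq wr] vM /=; rewrite IHq // IHr.
- by move=> /andP[wq wr] vM /=; rewrite IHq // IHr.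
- move=> /andP[ij wq] vM /=; split=> H a aM.
    have aM' := tM _ _ (vM j) aM.
    apply/IH => //; first exact: update_in.
    by apply: H => //; rewrite update_same update_neq.
  rewrite update_same update_neq // => aj.
  by apply/IH => //; [exact: update_in | exact: H].
- move=> /andP[ij wq] vM /=; split=> [[a [aM]]|[a [aj]]].
    rewrite update_same update_neq // => -[aj]; rewrite IH // => [H|].
      by exists a.
    exact: update_in.
  have aM := tM _ _ (vM j) aj.
  move=> H; exists a; split=> //; rewrite update_same update_neq //; split=> //.
  by apply/IH => //; exact: update_in.
Qed.

(** * Closure properties of the model *)

Lemma ctm_trans M x y : ctm M -> Vin x M -> Vin y x -> Vin y M.
Proof. by case=> _ tM _; apply: tM. Qed.

Lemma ctm_sat M p v : ctm M -> ZFC p -> (forall i, Vin (v i) M) -> sat M v p.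
Proof. by case=> _ _ [_ H] Tp; apply: H. Qed.

Lemma ctm_upair M x y : ctm M -> Vin x M -> Vin y M -> Vin (Vupair x y) M.
Proof.
move=> hM xM yM.
have /= H := ctm_sat hM ZFC_pairing (fun _ : nat => xM).
have [z [zM]] := H x xM y yM; rewrite /update /= => Hz.
apply: (Vin_eql _ zM); apply: Vext => w; rewrite Vin_upair; split=> Hw.
  exact: (proj1 (Hz w (ctm_trans hM zM Hw)) Hw).
have wM : Vin w M by case: Hw => /Veq_sym e; apply: Vin_eql e _.
exact: (proj2 (Hz w wM) Hw).
Qed.

Lemma ctm_pair M x y : ctm M -> Vin x M -> Vin y M -> Vin (Vpair x y) M.
Proof. by move=> hM xM yM; do !apply: ctm_upair. Qed.

Lemma ctm_pow M x : ctm M -> Vin x M -> exists P, Vin P M /\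
  forall y, Vin y P <-> Vin y M /\ forall z, Vin z y -> Vin z x.
Proof.
move=> hM xM.
have /= H := ctm_sat hM ZFC_powerset (fun _ : nat => xM).
have [P [PM]] := H x xM; rewrite /update /= => HP.
exists P; split=> // y; split=> [yP|[yM yx]].
  have yM := ctm_trans hM PM yP; split=> // z zy.
  exact: (proj1 (HP y yM) yP z (ctm_trans hM yM zy)).
by apply: (proj2 (HP y yM)) => z _; apply: yx.
Qed.

Lemma ctm_setU M x y : ctm M -> Vin x M -> Vin y M -> exists U, Vin U M /\
  forall z, Vin z U <-> Vin z x \/ Vin z y.
Proof.
move=> hM xM yM.
have /= H := ctm_sat hM ZFC_union (fun _ : nat => xM).
have [U [UM]] := H _ (ctm_upair hM xM yM); rewrite /update /= => HU.
exists U; split=> // z; split=> [zU|zxy].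
  have [w [_ [/Vin_upair[]e zw]]] := proj1 (HU z (ctm_trans hM UM zU)) zU.
    by left; apply: Vin_eqr zw.
  by right; apply: Vin_eqr zw.
have zM : Vin z M by case: zxy; apply: (ctm_trans hM).
apply: (proj2 (HU z zM)); case: zxy => Hz; [exists x|exists y]; do !split=> //.
  by apply/Vin_upair; left; apply: Veq_refl.
by apply/Vin_upair; right; apply: Veq_refl.
Qed.

(** By transitivity, what [M] takes for the empty set and for successors are the true ones, so its
    inductive set contains every numeral. *)
Lemma ctm_inductive M : ctm M -> exists I, Vin I M /\ forall n, Vin (Vnat n) I.
Proof.
move=> hM; have [_ _ [[x0 x0M] _]] := hM.
have /= := ctm_sat hM ZFC_infinity (fun _ : nat => x0M).
case=> I [IM []]; rewrite /update /= => -[z [zM [zI z0]]] IS.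
exists I; split=> //; elim=> [|n nI].
  apply: Vin_eql zI; apply: Vext => w; split=> [wz|/Vin_nat[]//].
  by case: (z0 w (ctm_trans hM zM wz) wz).
have nM := ctm_trans hM IM nI.
have [s [sM [sI Hs]]] := IS _ nM nI.
apply: Vin_eql sI; apply: Vext => w; rewrite Vin_natS; split=> Hw.
  exact: (proj1 (Hs w (ctm_trans hM sM Hw)) Hw).
have wM : Vin w M.
  by case: Hw => [|/Veq_sym e]; [exact: ctm_trans hM nM | exact: Vin_eql e nM].
exact: (proj2 (Hs w wM) Hw).
Qed.

Lemma ctm_nat M n : ctm M -> Vin (Vnat n) M.
Proof. by move=> hM; have [I [IM HI]] := ctm_inductive hM; apply: (ctm_trans hM IM). Qed.

(** Appending a digit [b] to [s] adjoins the single pair of [size s] and [b], so pairing and union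
    suffice at each step. *)
Lemma ctm_string M s : ctm M -> Vin (Vstring s) M.
Proof.
move=> hM; elim/last_ind: s => [|s b IH].
  apply: Vin_eql (ctm_nat 0 hM); apply: Vext => z.
  by split=> [/Vin_nat[]|/Vin_string[]].
have pM : Vin (Vpair (Vnat (size s)) (Vnat b)) M.
  by apply: ctm_pair => //; apply: ctm_nat.
have [U [UM HU]] := ctm_setU hM IH (ctm_upair hM pM pM).
apply: Vin_eql UM; apply: Vext => z; rewrite HU Vin_upair !Vin_string size_rcons.
split=> [[[i i_s e]|H]|[i]].
- by exists i; [exact: ltnW | rewrite nth_rcons i_s].
- by exists (size s) => //; rewrite nth_rcons ltnn eqxx; case: H.
- rewrite ltnS leq_eqVlt nth_rcons => /orP[/eqP->|i_s].
    by rewrite ltnn eqxx; right; left.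
  by rewrite i_s; left; exists i.
Qed.

(* Variables 0, 1, 2 are those of the separation axiom: the tested element, the
   set separated from, and the (unused) result; parameters start at 3. *)
Definition params (x : V) (ps : seq V) : nat -> V := nth x [:: x, x, x & ps].

(** Absoluteness replaces [sat] by [eval], and transitivity lets [x] range over all sets. Here [c]
    is the value of variable 2; the proof takes it to be [b]. *)
Lemma ctm_separation M p a ps : ctm M -> wf p -> ~~ free_in 2 (compile p) ->
  Vin a M -> (forall i, Vin (params a ps i) M) ->
  exists b c, Vin b M /\ forall x, Vin x b <-> Vin x a /\
    eval (update (update (update (params a ps) 1 a) 2 c) 0 x) p.
Proof.
move=> hM wp fp aM psM; have [_ tM _] := hM.
have /= H := ctm_sat hM (ZFC_separation fp) psM.
have [b [bM Hb]] := H a aM; exists b, b; split=> // x.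
have E y : Vin y M -> Vin y b <-> Vin y a /\
    eval (update (update (update (params a ps) 1 a) 2 b) 0 y) p.
  move=> yM; have := Hb y yM.
  set v := update _ 0 y => Hb'; have vM : forall l, Vin (v l) M.
    by do !apply: update_in => //.
  by rewrite sat_compile // in Hb'; case: Hb'.
split=> [xb|[xa Hx]].
  by apply/E => //; apply: (ctm_trans hM _ xb).
by apply/E => //; apply: (ctm_trans hM _ xa).
Qed.

Lemma params_in M x ps : Vin x M ->
  (forall i, i < size ps -> Vin (nth x ps i) M) ->
  forall i, Vin (params x ps i) M.
Proof.
move=> xM H [|[|[|i]]] //=; rewrite /params /=.
by have [/(nth_default x)->|/H] := leqP (size ps) i.
Qed.

(** * Omega and the set of strings *)

(** [~ Veq z z] stands for falsity, which [d0] has no constant for; evaluating [d_zero_or_succ] then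
    gives exactly this proposition. *)
Definition zero_or_succ (x : V) : Prop :=
  (forall z, Vin z x -> ~ Veq z z) \/
  exists k, Vin k x /\ (forall z, Vin z k -> Vin z x) /\
    (forall z, Vin z x -> Vin z k \/ Veq z k).

(** A bounded definition of the natural numbers. By membership induction, a predecessor [k] of [x]
    is a member and a subset of [x], hence inherits the hypothesis and is a numeral. *)
Lemma natP x : zero_or_succ x /\ (forall y, Vin y x -> zero_or_succ y) <->
  exists n, Veq x (Vnat n).
Proof.
split.
  elim/Vin_ind: x => x IH [[x0|[k [kx [ks xs]]]] hx].
    exists 0; apply: Vext => z; split=> [/x0/(_ (Veq_refl z))[]|].
    by case/Vin_nat.
  have [|n kn] := IH k kx; first by split=> [|y yk]; auto.
  exists n.+1; apply: Vext => z; rewrite Vin_natS; split=> [/xs[zk|zk]|].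
  - by left; apply: Vin_eqr zk.
  - by right; apply: Veq_trans kn.
  - move/Veq_sym in kn; case=> [zn|/Veq_sym zn].
      by apply/ks/(Vin_eqr kn).
    by apply: Vin_eql kx; apply: Veq_trans zn; apply: Veq_sym.
have Z y n : Veq y (Vnat n) -> zero_or_succ y.
  case: n => [|n] /VextE yn; first by left=> z /yn/Vin_nat[].
  right; exists (Vnat n); split; first by apply/yn/Vnat_in.
  by split=> z; [move=> zn; apply/yn/Vin_natS; left | move/yn/Vin_natS].
case=> n xn; split=> [|y]; first exact: Z xn.
by move/(Vin_eqr xn)/Vin_nat=> [m _ /Z].
Qed.

Definition d_zero_or_succ (x k z : nat) : d0 :=
  DOr (DAll z x (DNot (DEq z z)))
    (DEx k x (DAnd (DAll z k (DMem z x))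
      (DAll z x (DOr (DMem z k) (DEq z k))))).

Lemma ctm_omega M : ctm M -> exists W, Vin W M /\
  forall x, Vin x W <-> exists n, Veq x (Vnat n).
Proof.
move=> hM; have [I [IM HI]] := ctm_inductive hM.
have [|W [c [WM HW]]] := @ctm_separation M
  (DAnd (d_zero_or_succ 0 10 11) (DAll 12 0 (d_zero_or_succ 12 10 11)))
  I [::] hM isT isT IM; first exact: params_in.
exists W; split=> // x; rewrite -natP; split=> [/HW[] //|Hx]; apply/HW.
split=> //; have [n xn] := proj1 (natP x) Hx.
by apply: Vin_eql (HI n); apply: Veq_sym.
Qed.

(** Simplifies the evaluation of [d_pair_in] to plain membership of a pair. *)
Lemma Vin_ex x y : (exists z, Vin z y /\ Veq z x) <-> Vin x y.
Proof.
split=> [[z [zy e]]|xy]; first exact: Vin_eql zy.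
by exists x; split=> //; apply: Veq_refl.
Qed.

Definition d_pair_in (i b x z : nat) : d0 := DEx z x (DPair z i b).

(* Free variables: 0 is the candidate string, 3 is omega, 4 is 0 and 5 is 1. *)
Definition d_string : d0 :=
  DEx 6 3 (DAnd
    (DAll 7 0 (DEx 8 6 (DOr (DPair 7 8 4) (DPair 7 8 5))))
    (DAll 8 6 (DAnd (DOr (d_pair_in 8 4 0 9) (d_pair_in 8 5 0 9))
      (DNot (DAnd (d_pair_in 8 4 0 9) (d_pair_in 8 5 0 9)))))).

Lemma d_stringP W x v : (forall n, Vin n W <-> exists k, Veq n (Vnat k)) ->
  v 0 = x -> v 3 = W -> v 4 = Vnat 0 -> v 5 = Vnat 1 ->
  eval v d_string <-> exists s, Veq x (Vstring s).
Proof.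
move=> HW v0 v3 v4 v5; rewrite /= /update /= v0 v3 v4 v5; split.
  case=> n [/HW[k nk] [H1 H2]].
  have {}H2 i : i < k ->
      (Vin (Vpair (Vnat i) (Vnat 0)) x \/ Vin (Vpair (Vnat i) (Vnat 1)) x) /\
      ~ (Vin (Vpair (Vnat i) (Vnat 0)) x /\ Vin (Vpair (Vnat i) (Vnat 1)) x).
    move=> ik; rewrite -!Vin_ex; apply: H2.
    by apply: (Vin_eqr (Veq_sym nk)); apply/Vnat_in.
  (* The string is read off from [x]: exactly one of the pairs (i, 0) and (i, 1) belongs to [x], and
     the digit records which. *)
  exists (mkseq (fun i => `[< Vin (Vpair (Vnat i) (Vnat 1)) x >]) k).
  apply: Vext => z; rewrite Vin_string size_mkseq; split.
    move=> zx; have [i [/(Vin_eqr nk)/Vin_nat[m mk im] zi]] := H1 z zx.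
    exists m => //; rewrite nth_mkseq //.
    have P b : Veq z (Vpair i b) -> Veq z (Vpair (Vnat m) b).
      by move=> e; apply: (Veq_trans e); apply: Vpair_eq => //; apply: Veq_refl.
    have [_ N] := H2 m mk; case: zi => /P zi; have mx := Vin_eql zi zx.
      by rewrite asboolF // => m1; apply: N.
    by rewrite asboolT.
  case=> i ik; rewrite nth_mkseq // => /Veq_sym e; apply: Vin_eql e _.
  have [[m0|m1] N] := H2 i ik; first by rewrite asboolF // => m1; apply: N.
  by rewrite asboolT.
case=> s /VextE xs; exists (Vnat (size s)); split.
  by apply/HW; exists (size s); apply: Veq_refl.
split.
  move=> z /xs/Vin_string[i i_s zi]; exists (Vnat i); split; first exact/Vnat_in.
  by move: zi; case: nth; [right|left].
move=> n /Vin_nat[i i_s ni]; rewrite !Vin_ex.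
have P (b : bool) : Vin (Vpair n (Vnat b)) x <-> nth false s i = b.
  have e : Veq (Vpair n (Vnat b)) (Vpair (Vnat i) (Vnat b)).
    by apply: Vpair_eq => //; apply: Veq_refl.
  rewrite xs; split=> [/(Vin_eql e)/Vstring_in[]//|nb].
  by apply: (Vin_eql (Veq_sym e)); apply/Vstring_in.
by rewrite (P false) (P true); case: nth; split; auto; case.
Qed.

Lemma ctm_strings M : ctm M -> exists S, Vin S M /\
  forall x, Vin x S <-> exists s, Veq x (Vstring s).
Proof.
move=> hM; have [I [IM HI]] := ctm_inductive hM.
have [W [WM HW]] := ctm_omega hM.
(* Unordered pairs of numerals lie in [P1], ordered pairs in [P2], and strings, being sets of
   ordered pairs, in [P3]. *)
have [P1 [P1M HP1]] := ctm_pow hM IM.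
have [P2 [P2M HP2]] := ctm_pow hM P1M.
have [P3 [P3M HP3]] := ctm_pow hM P2M.
have N0 := ctm_nat 0 hM; have N1 := ctm_nat 1 hM.
have [|S [c [SM HS]]] := @ctm_separation M d_string P3
    [:: W; Vnat 0; Vnat 1] hM isT isT P3M.
  by apply: params_in => //; do 3?[case=> //].
exists S; split=> // x.
split=> [/HS[_]|[s xs]]; first exact: (proj1 (@d_stringP W x _ HW _ _ _ _)).
apply/HS; split; last by apply/(@d_stringP W x _ HW) => //; exists s.
have nI i j : Vin (Vupair (Vnat i) (Vnat j)) P1.
  apply/HP1; split; first by apply: ctm_upair => //; apply: ctm_nat.
  by move=> z /Vin_upair[] /Veq_sym e; apply: Vin_eql e _.
apply: (Vin_eql (Veq_sym xs)); apply/HP3; split; first exact: ctm_string.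
move=> z /Vin_string[i _ /Veq_sym e]; apply: (Vin_eql e); apply/HP2.
split; first by apply: ctm_pair => //; apply: ctm_nat.
by move=> y /Vin_upair[] /Veq_sym ey; apply: Vin_eql ey _.
Qed.

Lemma ctm_pairs M S : ctm M -> Vin S M -> exists A, Vin A M /\
  forall x y, Vin x S -> Vin y S -> Vin (Vpair x y) A.
Proof.
move=> hM SM.
have [P1 [P1M HP1]] := ctm_pow hM SM.
have [P2 [P2M HP2]] := ctm_pow hM P1M.
exists P2; split=> // x y xS yS.
have xM := ctm_trans hM SM xS; have yM := ctm_trans hM SM yS.
apply/HP2; split; first exact: ctm_pair.
move=> z /Vin_upair[] /Veq_sym e; apply: (Vin_eql e); apply/HP1;
  (split; first exact: ctm_upair);
  by move=> w /Vin_upair[] /Veq_sym ew; apply: Vin_eql ew _.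
Qed.

(** * Definable sets of pairs of strings *)

Lemma eval_eq p v w : (forall i, Veq (v i) (w i)) -> eval v p <-> eval w p.
Proof.
(* One direction for all assignments suffices; negation and implication use it with the two
   assignments exchanged. *)
suff H : forall v w, (forall i, Veq (v i) (w i)) -> eval v p -> eval w p.
  by move=> vw; split; apply: H => // i; apply: Veq_sym.
have U v' w' i a : (forall i, Veq (v' i) (w' i)) ->
    forall j, Veq (update v' i a j) (update w' i a j).
  by move=> vw j; rewrite /update; case: eqP => // _; apply: Veq_refl.
elim: p => [i j|i j|k i j|q IH|q IHq r IHr|q IHq r IHr|q IHq r IHr
  |i j q IH|i j q IH] {}v {}w vw /=.
- by move=> H; apply: Vin_eql (vw i) (Vin_eqr (vw j) H).
- by move=> H; apply: Veq_trans (Veq_sym (vw i)) (Veq_trans H (vw j)).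
- move=> H; apply: Veq_trans (Veq_sym (vw k)) (Veq_trans H _).
  exact: Vpair_eq.
- by move=> N H; apply: N; apply: IH H => l; apply: Veq_sym.
- by case=> Hq Hr; split; [apply: IHq vw Hq | apply: IHr vw Hr].
- by case=> Hq; [left; apply: IHq vw Hq | right; apply: IHr vw Hq].
- move=> H Hw; apply: (IHr _ _ vw) (H _); apply: (IHq _ _ _ Hw) => l.
  exact: Veq_sym.
- move=> H a aj; apply: IH (U _ _ _ _ vw) (H _ _).
  by apply: Vin_eqr aj; apply: Veq_sym.
- case=> a [aj H]; exists a; split; first exact: Vin_eqr aj.
  exact: IH (U _ _ _ _ vw) H.
Qed.

Lemma Vstring_inj s t : Veq (Vstring s) (Vstring t) -> s = t.
Proof.
move/VextE=> st; have /prefixP[r tE] : prefix s t by apply/Vstring_sub => x /st.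
have /size_prefix : prefix t s by apply/Vstring_sub => x /st.
rewrite tE size_cat; case: r {tE} => [|b r]; first by rewrite cats0.
by rewrite -[X in _ <= X]addn0 leq_add2l.
Qed.

(* Free variables of [p]: 3 is the set of strings, 4 and 5 the two components
   of the pair, 6 and above the further parameters. *)
Lemma ctm_string_pairs M S p ps (Q : seq bool -> seq bool -> Prop) :
  ctm M -> Vin S M -> (forall x, Vin x S <-> exists s, Veq x (Vstring s)) ->
  wf p -> ~~ free_in 2 (compile p) ->
  (forall i, i < size ps -> Vin (nth S ps i) M) ->
  (forall v s t, v 3 = S -> v 4 = Vstring s -> v 5 = Vstring t ->
    (forall i, i < size ps -> v (6 + i) = nth S ps i) -> eval v p <-> Q s t) ->
  exists B, Vin B M /\ forall x, Vin x B <->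
    exists s t, Veq x (Vpair (Vstring s) (Vstring t)) /\ Q s t.
Proof.
move=> hM SM HS wp fp psM HQ.
have [A [AM HA]] := ctm_pairs hM SM.
pose r := DEx 4 3 (DEx 5 3 (DAnd (DPair 0 4 5) p)).
(* Variable 3 holds [S]; the copies at 4 and 5 are placeholders that the quantifiers of [r]
   overwrite, so that [ps] starts at 6. *)
have psS i : Vin (params A [:: S, S, S & ps] i) M.
  apply: params_in => // -[|[|[|j]]] //=; rewrite !ltnS => jp.
  by rewrite (set_nth_default S) //; apply: psM.
have [|B [c [BM HB]]] := @ctm_separation M r A _ hM wp _ AM psS.
  by rewrite /=.
exists B; split=> // x; rewrite HB; set v := update _ 0 x.
have evalQ s t : eval (update (update v 4 (Vstring s)) 5 (Vstring t)) p <-> Q s t.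
  apply: HQ => // i ip; rewrite /update /= /params /=.
  exact: set_nth_default.
have inS s : Vin (Vstring s) S by apply/HS; exists s; apply: Veq_refl.
split=> [[_ /= [a [/HS[s a_s] [b [/HS[t bt] [xab pab]]]]]]|[s [t [xst Qst]]]].
  exists s, t; split; first by apply: Veq_trans xab _; apply: Vpair_eq.
  apply/evalQ; apply: (proj1 (eval_eq p _) pab) => i; rewrite /update.
  by do 2?[case: eqP => _]; rewrite //; apply: Veq_refl.
split; first by apply: (Vin_eql (Veq_sym xst)); apply: HA.
exists (Vstring s); split; first exact: inS.
exists (Vstring t); split; first exact: inS.
by split; [exact: xst | apply/evalQ].
Qed.

(** Genericity for dense sets given by a bounded formula: the set of codes of pairs in [Q] lies in
    [M], and as codes are injective, the condition that meets it satisfies [Q] itself. *)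
Lemma mutually_generic_meets M c d p ps (Q : seq bool -> seq bool -> Prop) S :
  ctm M -> mutually_generic_Cohen M c d ->
  Vin S M -> (forall x, Vin x S <-> exists s, Veq x (Vstring s)) ->
  wf p -> ~~ free_in 2 (compile p) ->
  (forall i, i < size ps -> Vin (nth S ps i) M) ->
  (forall v s t, v 3 = S -> v 4 = Vstring s -> v 5 = Vstring t ->
    (forall i, i < size ps -> v (6 + i) = nth S ps i) -> eval v p <-> Q s t) ->
  (forall s t, exists s' t', [/\ prefix s s', prefix t t' & Q s' t']) ->
  exists s t, [/\ initial_segments c s, initial_segments d t & Q s t].
Proof.
move=> hM [_ gen] SM HS wp fp psM HQ Qdense.
have [B [BM HB]] := ctm_string_pairs hM SM HS wp fp psM HQ.
have [|[s t] [[/= cs dt] /HB[s' [t' [/Vpair_inj[es et] Qst]]]]] := gen B BM.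
  split=> [x /HB[s [t [xst _]]]|[s t]]; first by exists (s, t).
  have [s' [t' [ss tt Q']]] := Qdense s t; exists (s', t'); split=> //.
  by apply/HB; exists s', t'; split=> //; apply: Veq_refl.
by exists s, t; rewrite (Vstring_inj es) (Vstring_inj et) in cs dt *.
Qed.

(** * Grafting *)

Lemma mutually_generic_unbounded M c d n :
  ctm M -> mutually_generic_Cohen M c d -> exists2 i, n <= i & d i.
Proof.
move=> hM hcd.
have [S [SM HS]] := ctm_strings hM; have [W [WM HW]] := ctm_omega hM.
(* Variables 6, 7 and 8 hold omega, [n] and 1. Not being a member of the numeral [n] expresses
   [n <= i]. *)
pose p := DEx 9 6 (DAnd (DNot (DMem 9 7)) (d_pair_in 9 8 5 10)).
pose Q (s t : seq bool) := exists i, [/\ n <= i, i < size t & nth false t i].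
have [|v s t v3 v4 v5 ve|s t|s [t [_ dt [i [ni it ti]]]]] :=
  @mutually_generic_meets M c d p [:: W; Vnat n; Vnat 1] Q S hM hcd SM HS isT isT.
- by do 3?[case=> //] => *; apply: ctm_nat.
- have := ve 0 isT; have := ve 1 isT; have := ve 2 isT => /= v8 v7 v6.
  rewrite /= /update /= v5 v6 v7 v8; split.
    case=> x [/HW[i xi] [xn /Vin_ex]].
    move/(Vin_eql (Vpair_eq xi (Veq_refl _)))/(Vstring_in i true)=> [it ti].
    exists i; split=> //; rewrite leqNgt; apply/negP => i_n; apply: xn.
    by apply: (Vin_eql (Veq_sym xi)); apply/Vnat_in.
  case=> i [ni it ti]; exists (Vnat i); split.
    by apply/HW; exists i; apply: Veq_refl.
  rewrite Vin_ex Vnat_in; split; first by apply/negP; rewrite -leqNgt.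
  by apply/(Vstring_in i true).
(* The [n] zeros push the new digit 1 to position [size t + n], which is at least [n]. *)
- exists s, (t ++ nseq n false ++ [:: true]); rewrite prefix_refl prefix_prefix.
  split=> //.
  exists (size t + n); split; first exact: leq_addl.
    by rewrite !size_cat size_nseq addnA addn1.
  by rewrite catA nth_cat size_cat size_nseq ltnn subnn.
- by exists i => //; move: ti; rewrite dt nth_mkseq.
Qed.

(** Positions where [t] is 1 stay free, as a graft may take any value there. Where [t] is 0, [w]
    must also be long enough to have a digit. *)
Definition agree (s t w : seq bool) : Prop :=
  forall i, i < size s -> i < size t -> nth false t i = false ->
  i < size w /\ nth false w i = nth false s i.

(** One tail serves the whole list: the strings are treated in turn, and lengthening [r] keeps every
    earlier [u] a prefix. *)
Lemma extension_into_dense D (L : seq (seq bool)) : @dense_in Add D ->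
  exists r, forall w, w \in L -> exists u, prefix u (w ++ r) /\ Vin (Vstring u) D.
Proof.
case=> _ dD; elim: L => [|w L [r Hr]]; first by exists [::].
have [u [/= /prefixP[r' uE] uD]] := dD (w ++ r).
exists (r ++ r') => w'; rewrite inE => /orP[/eqP->|/Hr[u' [u'p u'D]]].
  by exists u; rewrite catA -uE prefix_refl.
by exists u'; rewrite catA (prefix_trans u'p) ?prefix_prefix.
Qed.

Lemma agree_dense D s0 t0 : @dense_in Add D ->
  exists s t, [/\ prefix s0 s, prefix t0 t &
    forall w, agree s t w -> exists u, Vin (Vstring u) D /\ prefix u w].
Proof.
move=> dD; pose n := maxn (size s0) (size t0).
pose pad (x : seq bool) := x ++ nseq (n - size x) false.
have size_pad x : size x <= n -> size (pad x) = n.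
  by move=> xn; rewrite size_cat size_nseq subnKC.
have s0n := size_pad s0 (leq_maxl _ _); have t0n := size_pad t0 (leq_maxr _ _).
(* All strings of length [n] are handled at once, so whatever the first [n] digits of [w] are, they
   are covered. *)
have [r Hr] := extension_into_dense [seq val w | w : n.-tuple bool] dD.
(* The final digit forces every [w] that agrees to be long enough. *)
exists (pad s0 ++ rcons r false), (pad t0 ++ nseq (size r).+1 false).
rewrite /pad -!catA !prefix_prefix !catA -/(pad s0) -/(pad t0); split=> // w.
move: (pad s0) (pad t0) s0n t0n => s t sn tn aw.
(* Beyond position [n] the second string is constantly 0, so [w] is forced to copy [rcons r false]
   there. *)
have {}aw i : i < (size r).+1 ->
    n + i < size w /\ nth false w (n + i) = nth false (rcons r false) i.
  move=> ir; have := aw (n + i).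
  rewrite !size_cat !nth_cat sn tn size_rcons size_nseq ltn_add2l ir.
  by rewrite ltnNge leq_addr addKn nth_nseq if_same => /(_ isT isT erefl).
have [lw _] := aw (size r) (ltnSn _).
have nw : n < size w by apply: leq_ltn_trans lw; apply: leq_addr.
have twn : size (take n w) == n by rewrite size_takel // ltnW.
have [|u [ur uD]] := Hr (take n w).
  by apply/mapP; exists (Tuple twn); rewrite ?mem_enum.
(* It remains to see that [take n w ++ r] is a prefix of [w]. *)
exists u; split=> //; apply: (prefix_trans ur); apply/prefix_nthP => i.
rewrite size_cat (eqP twn) nth_cat (eqP twn).
have [i_n _|ni] := ltnP i n; first by rewrite nth_take // (ltn_trans i_n).
rewrite -{1}(subnKC ni) ltn_add2l => ir.
have [] := aw (i - n) (ltnW ir); rewrite subnKC // => iw ->.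
by rewrite nth_rcons ir.
Qed.

Lemma mutually_generic_agree M c d D :
  ctm M -> mutually_generic_Cohen M c d -> Vin D M -> @dense_in Add D ->
  exists s t, [/\ initial_segments c s, initial_segments d t &
    forall w, agree s t w -> exists u, Vin (Vstring u) D /\ prefix u w].
Proof.
move=> hM hcd DM dD.
have [S [SM HS]] := ctm_strings hM; have [W [WM HW]] := ctm_omega hM.
(* Variables 6, 7 and 8 hold [D], omega and 0, and 9 is [w]. The premise is [agree]: every member
   (i, b) of [s] with (i, 0) in [t] belongs to [w]. The conclusion asks for a member of [D] included
   in [w]. *)
pose p := DAll 9 3 (DImp
  (DAll 10 4 (DAll 11 7 (DAll 12 7 (DImp (DPair 10 11 12)
    (DImp (d_pair_in 11 8 5 13) (DMem 10 9))))))
  (DEx 14 6 (DAll 15 14 (DMem 15 9)))).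
pose Q s t := forall w, agree s t w -> exists u, Vin (Vstring u) D /\ prefix u w.
apply: (@mutually_generic_meets M c d p [:: D; W; Vnat 0] Q S hM hcd SM HS isT isT).
- by do 3?[case=> //] => *; apply: ctm_nat.
- move=> v s t v3 v4 v5 ve.
  have := ve 0 isT; have := ve 1 isT; have := ve 2 isT => /= v8 v7 v6.
  rewrite /= /update /= v3 v4 v5 v6 v7 v8.
  have natW i : Vin (Vnat i) W by apply/HW; exists i; apply: Veq_refl.
  have agreeP x w : Veq x (Vstring w) ->
      (forall z, Vin z (Vstring s) -> forall i, Vin i W -> forall b, Vin b W ->
        Veq z (Vpair i b) ->
        (exists a, Vin a (Vstring t) /\ Veq a (Vpair i (Vnat 0))) -> Vin z x) <->
      agree s t w.
    move=> xw; split=> H.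
      move=> i i_s it ti; apply/Vstring_in; apply: (Vin_eqr xw).
      apply: (H _ _ _ (natW i) _ (natW (nth false s i)) (Veq_refl _)).
        by apply/Vstring_in.
      by apply/Vin_ex/(Vstring_in i false).
    move=> z /Vin_string[i i_s zi] j jW b bW zjb /Vin_ex jt.
    have [ij _] := Vpair_inj (Veq_trans (Veq_sym zi) zjb).
    have := Vin_eql (Vpair_eq (Veq_sym ij) (Veq_refl _)) jt.
    move/(Vstring_in i false)=> [it ti].
    apply: (Vin_eql (Veq_sym zi)); apply: (Vin_eqr (Veq_sym xw)).
    exact/Vstring_in/H.
  split=> H.
    move=> w aw; have [] := H (Vstring w).
    - by apply/HS; exists w; apply: Veq_refl.
    - exact/(agreeP _ w)/aw/Veq_refl.
    move=> x [xD xw]; have [u xu] := (proj1 dD) x xD.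
    exists u; split; first exact: Vin_eql xD.
    by apply/Vstring_sub => z zu; apply: xw; apply: Vin_eqr zu; apply: Veq_sym.
  move=> x /HS[w xw] /(agreeP x w xw)/H[u [uD uw]].
  exists (Vstring u); split=> // z /(proj2 (Vstring_sub u w) uw).
  by apply: Vin_eqr; apply: Veq_sym.
- by move=> s t; apply: agree_dense.
Qed.

(** On the set coded by [d] this is the order isomorphism of the graft: it sends the k-th one of
    [d], counted from 0, to k. *)
Definition rank (d : nat -> bool) (x : nat) : nat := count d (iota 0 x).

Lemma rankS d x : rank d x.+1 = rank d x + d x.
Proof. by rewrite /rank -addn1 iotaD count_cat /= addn0. Qed.

Lemma rank_le d x y : x <= y -> rank d x <= rank d y.
Proof.
move=> xy; rewrite -(subnKC xy) /rank iotaD count_cat; exact: leq_addr.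
Qed.

Lemma rank_lt (d : nat -> bool) x y : d x -> x < y -> rank d x < rank d y.
Proof.
by move=> dx xy; apply: leq_trans (rank_le d xy); rewrite rankS dx addn1.
Qed.

Lemma rank_surj (d : nat -> bool) : (forall n, exists2 i, n <= i & d i) ->
  forall k, exists2 x, d x & rank d x = k.
Proof.
move=> inf.
(* Climbing from [n] to the first one of [d] at or above it passes no ones, so the rank is
   unchanged; the induction is on the distance to some known one. *)
have least n : exists2 x, d x & rank d x = rank d n.
  have [m /subnKC <-] := inf n; move: (m - n) => k.
  elim: k n => [|k IH] n; first by rewrite addn0; exists n.
  move=> dm.
  case dn: (d n); first by exists n.
  have [|x dx xE] := IH n.+1; first by rewrite addSnnS.
  by exists x => //; rewrite xE rankS dn addn0.
elim=> [|k [x dx <-]]; first exact: (least 0).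
by have [y dy yE] := least x.+1; exists y => //; rewrite yE rankS dx addn1.
Qed.

Lemma rank_order_bij (d : nat -> bool) : (forall n, exists2 i, n <= i & d i) ->
  order_bij (d @^-1` [set true]) setT (rank d).
Proof.
move=> inf; split; last by move=> x y dx _; apply: rank_lt.
split=> //.
- move=> x y /set_mem dx /set_mem dy xy.
  by have [/(rank_lt dx)|/(rank_lt dy)|//] := ltngtP x y; rewrite xy ltnn.
- by move=> k _; have [x dx <-] := rank_surj inf k; exists x.
Qed.

Lemma initial_segmentsP h s : initial_segments h s <->
  forall i, i < size s -> nth false s i = h i.
Proof.
split=> [-> i|H]; first by rewrite size_mkseq => ilt; rewrite nth_mkseq.
apply: (@eq_from_nth _ false); first by rewrite size_mkseq.
by move=> i ilt; rewrite nth_mkseq // H.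
Qed.

Lemma initial_segments_mkseq h n : initial_segments h (mkseq h n).
Proof. by rewrite /initial_segments /= size_mkseq. Qed.

Lemma initial_segments_prefix h s t :
  initial_segments h t -> prefix s t -> initial_segments h s.
Proof.
move=> /initial_segmentsP ht /prefix_nthP st; apply/initial_segmentsP => i i_s.
by have [it <-] := st i i_s; apply: ht.
Qed.

Lemma initial_segments_filter h : @is_filter Add (initial_segments h).
Proof.
have ext s n : initial_segments h s -> size s <= n -> prefix s (mkseq h n).
  move=> /initial_segmentsP hs sn; apply/prefix_nthP => i i_s.
  have i_n := leq_trans i_s sn.
  by rewrite size_mkseq nth_mkseq // hs.
split=> [|s t|s t hs ht].
- by exists (mkseq h 0); apply: initial_segments_mkseq.
- exact: initial_segments_prefix.
- exists (mkseq h (maxn (size s) (size t))); split.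
  + exact: initial_segments_mkseq.
  + by apply: ext => //; apply: leq_maxl.
  + by apply: ext => //; apply: leq_maxr.
Qed.

Theorem theorem5p4 (M : V) (hM : ctm M) (c d : nat -> bool)
    (hcd : mutually_generic_Cohen M c d) (g : nat -> bool) :
  exists h : nat -> bool,
    is_graft (as_partial c) (d @^-1` [set true]) (as_partial g) (as_partial h) /\
    Cohen_real M h.
Proof.
have inf n := mutually_generic_unbounded n hM hcd.
pose h x := if d x then g (rank d x) else c x.
exists h; split.
  split=> //; exists (rank d); split.
  - have -> : pdom (as_partial g) = setT by apply/seteqP; split.
    exact: rank_order_bij.
  - by move=> x /= dx; rewrite /as_partial /h dx.
  - by move=> x /= /negP/negbTE dx; rewrite /as_partial /h dx.
split=> [|D DM dD]; first exact: initial_segments_filter.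
have [s [t [/initial_segmentsP cs /initial_segmentsP dt H]]] :=
  mutually_generic_agree hM hcd DM dD.
(* This initial segment of [h] covers every position that [agree] constrains; [d] is 0 there, so [h]
   copies [c], of which [s] is an initial segment. *)
have [|u [uD uh]] := H (mkseq h (maxn (size s) (size t))).
  move=> i i_s it ti; have ilt : i < maxn (size s) (size t).
    by rewrite leq_max i_s.
  by rewrite size_mkseq nth_mkseq // /h -dt // ti cs.
exists u; split=> //; apply: initial_segments_prefix uh.
exact: initial_segments_mkseq.
Qed.
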